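(* Let $\{X_n\}_{n\ge 0}$ be a stochastic process with values in $\mathcal{S}$, adapted to a filtration $\{\mathcal{F}_n\}_{n\ge 0}$, with $X_0=x_0\in\mathcal{S}$. Suppose there exist measurable functions $V:\mathcal{S}\to[0,\infty)$ and $\varphi:\mathcal{S}\to[0,\infty)$, a measurable set $\mathcal{D}\subset\mathcal{S}$, and a constant $A>0$ such that: (a) for all $n\ge 0$, $\mathbb{E}_{x_0}[V(X_{n+1})-V(X_n)\mid\mathcal{F}_n]\le -A$ on $\{X_n\notin\mathcal{D}\}$; (b) for some $p>2$ and all $n\ge 0$, $$\Xi_n:=\mathbb{E}_{x_0}\Big[\big|V(X_{n+1})-\mathbb{E}(V(X_{n+1})\mid\mathcal{F}_n)\big|^p\,\Big|\,\mathcal{F}_n\Big]\le\varphi(X_n),$$ where $\varphi(x)\le C_\varphi(1+V^s(x))$ for all $x\in\mathcal{S}$, for some $0\le s<p/2-1$ and some constant $C_\varphi>0$; (c) $\sup_{x\in\mathcal{D}}V(x)<\infty$, and for some finite constant $\bar B_0(x_0)$ and all $n\ge 0$, $$\mathbb{E}_{x_0}\Big[\big(\mathbb{E}[V(X_{n+1})\mid\mathcal{F}_n]\big)^p\,1_{\{X_n\in\mathcal{D}\}}\Big]<\bar B_0(x_0).$$ Then $$\sup_{n}\mathbb{E}_{x_0}\big[V(X_n)^r\big]<\infty\qquad\text{for every } 0\le r<\varsigma(s,p),$$ where $$\varsigma(s,p)=\begin{cases}p\left(1-\frac{s}{p-2}\right)-1, & \text{if } 2<p<4 \text{ and } s\in\left[0,\frac{(p-2)^2}{2p}\right)\cup\left[1-\frac2p,\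 \frac p2-1\right),\\[1mm] p\left(1-\frac{s}{p-2}\right)-1, & \text{if } p\ge 4 \text{ and } s\in\left[0,\frac p2-1\right),\\[1mm] p-2, & \text{if } 2<p<4 \text{ and } \frac{(p-2)^2}{2p}\le s<1-\frac2p.\end{cases}$$
   Context: $\mathcal{S}$ is a topological space with its Borel $\sigma$-algebra; all random variables live on a probability space $(\Omega,\mathcal{F},\mathbb{P})$. The process is not assumed to be Markov. $\mathbb{E}_{x_0}$ denotes expectation given $X_0=x_0$. *)

(* Defs.v *)
From HB Require Import structures.
From mathcomp Require Import all_boot all_order all_algebra.
From mathcomp Require Import all_classical all_reals all_analysis measurable_realfun.

Set Implicit Arguments.
Unset Strict Implicit.
Unset Printing Implicit Defensive.

Import Order.TTheory GRing.Theory Num.Theory.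
Import numFieldNormedType.Exports.

Local Open Scope classical_set_scope.
Local Open Scope ring_scope.

Definition borel (S : topologicalType) : set (set S) := <<s @open S >>.

(* The sigma-algebras are explicit set systems rather than [measurableType]
   structures: several of them (a whole filtration) live on one type, and a
   [measurableType] would force the state space to be pointed. *)
Definition measurable_wrt (T U : Type) (G : set (set T)) (H : set (set U))
    (f : T -> U) : Prop :=
  forall B, H B -> G (f @^-1` B).

Section process.
Context (d : measure_display) (Omega : measurableType d).

Definition filtration (F : nat -> set (set Omega)) : Prop :=
  [/\ forall n, sigma_algebra setT (F n),
      forall n, F n `<=` measurable
    & forall m n, (m <= n)%N -> F m `<=` F n].

Definition adapted (S : topologicalType) (F : nat -> set (set Omega))
    (X : nat -> Omega -> S) : Prop :=
  forall n, measurable_wrt (F n) (@borel S) (X n).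

Context (R : realType) (P : probability Omega R).

Local Open Scope ereal_scope.

Definition cond_exp_version_ge0 (G : set (set Omega)) (f g : Omega -> \bar R)
    : Prop :=
  [/\ forall w, 0 <= g w,
      measurable_wrt G (@measurable _ (\bar R)) g
    & forall E, G E -> \int[P]_(w in E) g w = \int[P]_(w in E) f w].

(* [g] is a version of E[f | G] = E[f^+ | G] - E[f^- | G], where [f] need not be
   integrable: it is only required that the difference is almost surely not of
   the form oo - oo. For integrable [f] this is the usual conditional
   expectation, and for [0 <= f] it is the usual [0, +oo]-valued one. *)
Definition cond_exp_version (G : set (set Omega)) (f g : Omega -> \bar R)
    : Prop :=
  measurable_wrt G (@measurable _ (\bar R)) g /\
  exists gp gn : Omega -> \bar R,
    [/\ cond_exp_version_ge0 G f^\+ gp,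
        cond_exp_version_ge0 G f^\- gn,
        {ae P, forall w, gp w < +oo \/ gn w < +oo}
      & {ae P, forall w, g w = gp w - gn w}].

End process.

(* Meaningful for 2 < p and 0 <= s < p / 2 - 1, where the last branch is exactly
   2 < p < 4 and (p - 2)^2 / (2 p) <= s < 1 - 2 / p. *)
Definition varsigma (R : realType) (s p : R) : R :=
  if (2 < p < 4) && ((0 <= s < (p - 2) ^+ 2 / (2 * p))
                     || (1 - 2 / p <= s < p / 2 - 1))
  then p * (1 - s / (p - 2)) - 1
  else if (4 <= p) && (0 <= s < p / 2 - 1)
  then p * (1 - s / (p - 2)) - 1
  else p - 2.

(* Main.v *)
Require Import Defs.
From HB Require Import structures.
From mathcomp Require Import all_boot all_order all_algebra.
From mathcomp Require Import all_classical all_reals all_analysis measurable_realfun.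
From mathcomp Require Import ring lra.

Set Implicit Arguments.
Unset Strict Implicit.
Unset Printing Implicit Defensive.

Import Order.TTheory GRing.Theory Num.Theory.
Import numFieldNormedType.Exports.

Local Open Scope classical_set_scope.
Local Open Scope ring_scope.

(** The bound holds for every r < p - 1, and varsigma s p never exceeds p - 1.

    Write V_n for V (X_n), e_n for E[V_{n+1} | F_n] and xi for V_{n+1} - e_n.
    A second order expansion of x^p around e_n leaves, after conditioning, an
    error of order V_n^(p-2) E[xi^2 | F_n] + E[|xi|^p | F_n]. Since
    E[|xi|^p | F_n] is at most of order V_n^s, this error is of order
    V_n^(p-2+2s/p), which is negligible against the gain V_n^(p-1) produced by
    the drift because 2s/p < 1. The same computation applies to V_n + c for
    every c >= 0, so half of the drift can be spent on a deterministic clock: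
    with eps = A/2 and K large, (V_n + eps n)^p is a supermartingale as long as
    V stays above K [lyapunov_pointwise, lyapunov_step].

    Fix a time n and look at the last j <= n with V_j <= K. The step leaving
    that level has bounded p-th moment, by (b) and (c) [return_bound]; from
    there on, (V + clock)^p has nonincreasing expectation, and at time n the
    clock reads eps (n - j) [excursion_bound]. Trading p - r powers for the
    clock, the contribution of j to E[V_n^r] is at most a constant times
    (n - j)^-(p-r). As p - r > 1, the sum over j is bounded uniformly in n
    [last_exit_decomposition, moment_bound]. *)

(** * Inequalities for real powers *)

(** The tangent line inequality for the convex function x^p, obtained from
    Young's inequality m x^(p-1) <= m^p / p + (1 - 1/p) x^p. *)
Lemma powR_sub_le (R : realType) (x m p : R) : 0 <= x -> 0 <= m -> 1 < p ->
  x `^ p - m `^ p <= p * x `^ (p - 1) * (x - m).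
Proof.
move=> x0 m0 p1.
have p0 : 0 < p by lra.
have pn0 : p != 0 by rewrite gt_eqF.
have q0 : 0 < p / (p - 1) by rewrite divr_gt0 //; lra.
have p1n0 : p - 1 != 0 by rewrite gt_eqF //; lra.
have := @conjugate_powR R m (x `^ (p - 1)) p (p / (p - 1)) m0 (powR_ge0 _ _)
  p0 q0.
have -> : p^-1 + (p / (p - 1))^-1 = 1 by field; rewrite pn0 p1n0.
have -> : (x `^ (p - 1)) `^ (p / (p - 1)) = x `^ p.
  by rewrite -powRrM; congr (_ `^ _); field.
have -> : x `^ p / (p / (p - 1)) = x `^ p - x `^ p / p by field; rewrite pn0 p1n0.
move=> /(_ erefl) H.
rewrite mulrBr -mulrA [x `^ (p - 1) * x]mulrC mulr_powRB1 //.
suff : p * (m * x `^ (p - 1)) <= m `^ p + (p - 1) * x `^ p by lra.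
apply: le_trans (ler_wpM2l (ltW p0) H) _.
rewrite le_eqVlt; apply/orP; left; apply/eqP; field.
by rewrite pn0.
Qed.

(** Two uses of the tangent inequality play the role of a Taylor expansion: the
    first, based at x, produces the slope x^(p-1); the second, with exponent
    p - 1, compares this slope with m^(p-1). *)
Lemma powR_taylor2 (R : realType) (x m p : R) : 0 <= x -> 0 <= m -> 2 < p ->
  x `^ p <= m `^ p + p * m `^ (p - 1) * (x - m)
    + p * (p - 1) * 2 `^ (p - 2)
      * (m `^ (p - 2) * (x - m) ^+ 2 + `|x - m| `^ p).
Proof.
move=> x0 m0 p2.
have p0 : 0 < p by lra.
pose M := Num.max x m.
have M0 : 0 <= M by rewrite /M le_max x0.
have H1 : x `^ p - m `^ p <= p * x `^ (p - 1) * (x - m).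
  by apply: powR_sub_le => //; lra.
have e1 : p - 1 - 1 = p - 2 by ring.
have Mx : x `^ (p - 2) <= M `^ (p - 2).
  by apply: ge0_ler_powR; rewrite ?nnegrE ?le_max ?lexx //; lra.
have Mm : m `^ (p - 2) <= M `^ (p - 2).
  by apply: ge0_ler_powR; rewrite ?nnegrE ?le_max ?lexx ?orbT //; lra.
have H2 : (x `^ (p - 1) - m `^ (p - 1)) * (x - m)
          <= (p - 1) * M `^ (p - 2) * (x - m) ^+ 2.
  have A1 : x `^ (p - 1) - m `^ (p - 1) <= (p - 1) * x `^ (p - 2) * (x - m).
    by rewrite -e1; apply: powR_sub_le => //; lra.
  have A2 : m `^ (p - 1) - x `^ (p - 1) <= (p - 1) * m `^ (p - 2) * (m - x).
    by rewrite -e1; apply: powR_sub_le => //; lra.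
  have pp : 0 <= p - 1 by lra.
  have [mx|xm] := leP m x.
    have d0 : 0 <= x - m by lra.
    rewrite expr2 mulrA; apply: ler_wpM2r => //; apply: le_trans A1 _.
    by apply: ler_wpM2r => //; apply: ler_wpM2l.
  have d0 : 0 <= m - x by lra.
  rewrite -mulrNN !opprB -sqrrN opprB expr2 mulrA.
  apply: ler_wpM2r => //; apply: le_trans A2 _.
  by apply: ler_wpM2r => //; apply: ler_wpM2l.
(* M is at most twice the larger of m and |x - m|. *)
have H3 : M `^ (p - 2) * (x - m) ^+ 2
     <= 2 `^ (p - 2) * (m `^ (p - 2) * (x - m) ^+ 2 + `|x - m| `^ p).
  set u := `|x - m|.
  have u0 : 0 <= u by exact: normr_ge0.
  have sq : (x - m) ^+ 2 = u ^+ 2 by rewrite /u real_normK ?num_real.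
  have up : u `^ p = u `^ (p - 2) * u ^+ 2.
    rewrite -powR_mulrn // -powRD ?subrK //.
    by apply/implyP => /eqP h; exfalso; move: h; lra.
  rewrite sq up -mulrDl mulrA; apply: ler_wpM2r; first exact: exprn_ge0.
  have Mu : M <= m + u.
    by rewrite /M ge_max /u; have := ler_norm (x - m); have := normr_ge0 (x - m); lra.
  have [um|mu] := leP u m.
    apply: (@le_trans _ _ ((2 * m) `^ (p - 2))).
      by apply: ge0_ler_powR; rewrite ?nnegrE //; lra.
    rewrite powRM // ?ler_wpM2l ?powR_ge0 // lerDl powR_ge0 //.
  apply: (@le_trans _ _ ((2 * u) `^ (p - 2))).
    by apply: ge0_ler_powR; rewrite ?nnegrE //; lra.
  by rewrite powRM // ?ler_wpM2l ?powR_ge0 // lerDr powR_ge0.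
have H4 : p * ((x `^ (p - 1) - m `^ (p - 1)) * (x - m))
    <= p * (p - 1) * 2 `^ (p - 2) * (m `^ (p - 2) * (x - m) ^+ 2 + `|x - m| `^ p).
  rewrite -!(mulrA p); apply: ler_wpM2l; first exact: ltW.
  apply: le_trans H2 _; rewrite -!(mulrA (p - 1)); apply: ler_wpM2l => //.
  lra.
have -> : p * m `^ (p - 1) * (x - m) = p * x `^ (p - 1) * (x - m)
   - p * ((x `^ (p - 1) - m `^ (p - 1)) * (x - m)) by ring.
lra.
Qed.

(** A linear substitute for Hoelder's inequality between the second and the p-th
    conditional moments of u: with t^p equal to the latter it bounds the former
    by 2 t^2. *)
Lemma sqr_le_young (R : realType) (u t p : R) : 0 <= u -> 0 < t -> 2 < p ->
  u ^+ 2 <= t ^+ 2 + t `^ (2 - p) * u `^ p.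
Proof.
move=> u0 t0 p2; have [ut|tu] := leP u t.
  have : u ^+ 2 <= t ^+ 2 by rewrite lerXn2r ?nnegrE // ltW.
  by move=> h; apply: le_trans h _; rewrite lerDl mulr_ge0 ?powR_ge0.
have u1 : 0 < u := lt_trans t0 tu.
have up : u `^ p = u `^ (p - 2) * u ^+ 2.
  rewrite -powR_mulrn // -powRD ?subrK //.
  by apply/implyP => /eqP h; exfalso; move: h; lra.
apply: (@le_trans _ _ (t `^ (2 - p) * u `^ p)); last first.
  by rewrite lerDr sqr_ge0.
rewrite up mulrA ler_peMl ?sqr_ge0 //.
rewrite -(opprB p 2) powRN mulrC ler_pdivlMr ?powR_gt0 // mul1r.
by apply: ge0_ler_powR; rewrite ?nnegrE //; lra.
Qed.

(** Telescoping: q (k+1)^-(1+q) is at most k^-q - (k+1)^-q. The exponent is first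
    lowered to 1 + q with q < 1, where concavity gives x^q <= 1 - q (1 - x),
    used at x = k / (k+1). *)
Lemma sum_powRN_bounded (R : realType) (a : R) : 1 < a ->
  exists C : R, forall n, \sum_(k < n) (k.+1)%:R `^ (- a) <= C.
Proof.
move=> a1.
pose q := Num.min (a - 1) (2^-1).
have q0 : 0 < q by rewrite lt_min; apply/andP; split; lra.
have q1 : q < 1 by rewrite gt_min; apply/orP; right; lra.
have qa : q <= a - 1 by rewrite ge_min lexx.
exists (1 + q^-1).
have step (k : nat) : q * (k.+2)%:R `^ (- a) <= (k.+1)%:R `^ (- q) - (k.+2)%:R `^ (- q).
  set u : R := k.+1%:R; set v : R := k.+2%:R.
  have u0 : 0 < u by rewrite ltr0n.
  have v0 : 0 < v by rewrite ltr0n.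
  have uv : v = u + 1 by rewrite /u /v -natr1.
  have v1 : 1 <= v by lra.
  have x0 : 0 <= u / v by rewrite divr_ge0 // ltW.
  have Y : (u / v) `^ q <= 1 - q / v.
    have qn0 : q != 0 by rewrite gt_eqF.
    have := @conjugate_powR R ((u / v) `^ q) 1 q^-1 (1 - q)^-1 (powR_ge0 _ _) ler01.
    rewrite !invr_gt0 !invrK => /(_ q0) H.
    have q1' : 0 < 1 - q by lra.
    have := H q1'; rewrite subrKC => /(_ erefl).
    rewrite -powRrM mulfV // powRr1 // powR1 mulr1 mul1r => Y.
    apply: le_trans Y _.
    have -> : u / v = 1 - v^-1.
      have -> : u = v - 1 by lra.
      by field; rewrite gt_eqF.
    by rewrite le_eqVlt; apply/orP; left; apply/eqP; ring.
  apply: (@le_trans _ _ (q / v * v `^ (- q))).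
    rewrite -mulrA; apply: ler_wpM2l; first exact: ltW.
    rewrite -[v^-1]powR_inv1 ?(ltW v0) // -powRD; last by rewrite (gt_eqF v0) implybT.
    by apply: ler_powR => //; lra.
  have E : v `^ (- q) = (u / v) `^ q * u `^ (- q).
    rewrite powRM ?invr_ge0 ?(ltW u0) ?(ltW v0) // mulrAC -powRD; last by rewrite (gt_eqF u0) implybT.
    by rewrite subrr powRr0 mul1r -powR_inv1 ?(ltW v0) // -powRrM mulN1r.
  have -> : u `^ (- q) - v `^ (- q) = (1 - (u / v) `^ q) * u `^ (- q).
    by rewrite E; ring.
  apply: (@le_trans _ _ (q / v * u `^ (- q))).
    apply: ler_wpM2l; first by rewrite divr_ge0 ?ltW.
    rewrite !powRN lef_pV2 ?posrE ?powR_gt0 //.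
    by apply: ge0_ler_powR; rewrite ?nnegrE //; lra.
  by apply: ler_wpM2r; [exact: powR_ge0|rewrite lerBrDr addrC -lerBrDr].
suff main n : \sum_(k < n.+1) (k.+1)%:R `^ (- a) <= 1 + q^-1 * (1 - n.+1%:R `^ (- q)).
  case=> [|n]; first by rewrite big_ord0 addr_ge0 // invr_ge0 ltW.
  apply: le_trans (main n) _; rewrite lerD2l ler_piMr ?invr_ge0 ?(ltW q0) //.
elim: n => [|n IH].
  by rewrite big_ord_recr big_ord0 /= add0r !powR1 subrr mulr0 addr0.
rewrite big_ord_recr /=; apply: le_trans (lerD IH (lexx _)) _.
rewrite -addrA lerD2l -lerBrDl -mulrBr mulrC ler_pdivlMr // mulrC.
apply: le_trans (step n) _; lra.
Qed.

(** The pathwise form of the supermartingale inequality. Here b is the present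
    value V_n + c, m the predicted next value (at least delta below b), x the
    actual one. The term p m^(p-1) (x - m) will have mean zero and the term
    w (|x - m|^p - Cphi (1 + b^s)) nonpositive mean, so that integration yields
    E[x^p] <= E[b^p]. Both sides are sums of
    nonnegative terms, so that it can be integrated before integrability is
    known. *)
Lemma lyapunov_pointwise (R : realType) (p s delta Cphi : R) :
  2 < p -> 0 <= s -> s < p / 2 - 1 -> 0 < delta -> 0 < Cphi ->
  exists (K : R) (w : R -> R), [/\ 1 <= K, measurable_fun setT w,
    forall b, 0 <= w b &
    forall b m x, K <= b -> 0 <= m -> m <= b - delta -> 0 <= x ->
    x `^ p + p * m `^ (p - 1) * m + w b * (Cphi * (1 + b `^ s))
    <= b `^ p + p * m `^ (p - 1) * x + w b * `|x - m| `^ p].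
Proof.
move=> p2 s0 sp d0 Cphi0.
have p0 : 0 < p by lra.
(* In the Young inequality the threshold is t = b^(s/p), the size of the noise
   when its p-th moment is of order b^s. *)
pose k := s / p.
have k0 : 0 <= k by rewrite divr_ge0 // ltW.
have sk : s = k * p by rewrite /k divfK // gt_eqF.
have k2 : 0 < 1 - 2 * k.
  have : k < 2^-1 by rewrite /k ltr_pdivrMr //; lra.
  lra.
pose C : R := p * (p - 1) * 2 `^ (p - 2).
have C0 : 0 <= C by rewrite /C !mulr_ge0 ?powR_ge0 //; lra.
pose w b := C * (b `^ ((p - 2) * (1 - k)) + 1).
have w0 b : 0 <= w b by rewrite mulr_ge0 // addr_ge0 // powR_ge0.
pose M := C * (1 + 4 * Cphi).
have M0 : 0 <= M by rewrite mulr_ge0 //; lra.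
pose K := Num.max 1 ((M / delta) `^ (1 - 2 * k)^-1).
exists K, w; split => //.
- by rewrite /K le_max lexx.
- apply: measurable_funM; first exact: measurable_cst.
  by apply: measurable_funD; [exact: measurable_powR|exact: measurable_cst].
move=> b m x Kb m0 mb x0.
have b1 : 1 <= b by apply: le_trans Kb; rewrite le_max lexx.
have b0 : 0 < b by lra.
have bD (u v : R) : b `^ (u + v) = b `^ u * b `^ v.
  by apply: powRD; rewrite (gt_eqF b0) implybT.
(* The choice of K: beyond it the drift beats the noise, as 2 s / p < 1. *)
have Hb : M * b `^ (p - 2 + 2 * k) <= delta * b `^ (p - 1).
  have -> : p - 1 = (1 - 2 * k) + (p - 2 + 2 * k) by ring.
  rewrite (bD (1 - 2 * k)) mulrA; apply: ler_wpM2r; first exact: powR_ge0.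
  rewrite mulrC -ler_pdivrMr //.
  have KM : (M / delta) `^ (1 - 2 * k)^-1 <= b.
    by apply: le_trans Kb; rewrite /K le_max lexx orbT.
  have : ((M / delta) `^ (1 - 2 * k)^-1) `^ (1 - 2 * k) <= b `^ (1 - 2 * k).
    by apply: ge0_ler_powR => //; rewrite ?nnegrE ?powR_ge0 ?(ltW b0) ?(ltW k2).
  by rewrite -powRrM mulVf ?gt_eqF // powRr1 // divr_ge0 // ltW.
have H1 := powR_taylor2 x0 m0 p2.
set xi := `|x - m| in H1 *.
have sq : (x - m) ^+ 2 = xi ^+ 2 by rewrite /xi real_normK ?num_real.
have xi0 : 0 <= xi by exact: normr_ge0.
have H2 : m `^ (p - 2) * xi ^+ 2
    <= b `^ (p - 2 + 2 * k) + b `^ ((p - 2) * (1 - k)) * xi `^ p.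
  have mb2 : m `^ (p - 2) <= b `^ (p - 2).
    by apply: ge0_ler_powR; rewrite ?nnegrE //; lra.
  have Y := @sqr_le_young R xi (b `^ k) p xi0 (powR_gt0 _ b0) p2.
  apply: (@le_trans _ _ (b `^ (p - 2) * ((b `^ k) ^+ 2 + (b `^ k) `^ (2 - p) * xi `^ p))).
    by apply: ler_pM => //; [exact: powR_ge0|exact: sqr_ge0].
  rewrite mulrDr mulrA -powRrM -bD -powR_mulrn ?powR_ge0 // -powRrM -bD.
  have -> : k * 2%:R = 2 * k by ring.
  by have -> : p - 2 + k * (2 - p) = (p - 2) * (1 - k) by ring.
have H3 : m `^ p <= b `^ p - delta * b `^ (p - 1).
  rewrite -(mulr_powRB1 (ltW b0) p0) -(mulr_powRB1 m0 p0) -mulrBl.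
  apply: ler_pM => //; first exact: powR_ge0.
  by apply: ge0_ler_powR; rewrite ?nnegrE //; lra.
have H4 : w b * (Cphi * (1 + b `^ s)) <= C * (4 * Cphi) * b `^ (p - 2 + 2 * k).
  have bs1 : 1 <= b `^ s by rewrite -[leLHS](powRr0 b); apply: ler_powR.
  have e0 : 0 <= (p - 2) * (1 - k) by apply: mulr_ge0; lra.
  have bw1 : 1 <= b `^ ((p - 2) * (1 - k)) by rewrite -[leLHS](powRr0 b); apply: ler_powR.
  have -> : p - 2 + 2 * k = (p - 2) * (1 - k) + s by rewrite sk; ring.
  rewrite bD /w /= -2!(mulrA C); apply: ler_wpM2l => //.
  set W := b `^ _ in bw1 *; set B := b `^ s in bs1 *.
  have -> : 4 * Cphi * (W * B) = Cphi * (4 * (W * B)) by ring.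
  rewrite mulrCA; apply: ler_wpM2l; first exact: ltW.
  nra.
have H5 : C * (m `^ (p - 2) * xi ^+ 2) <= C * (b `^ (p - 2 + 2 * k) + b `^ ((p - 2) * (1 - k)) * xi `^ p).
  exact: ler_wpM2l.
rewrite sq -/C in H1.
rewrite /M in Hb; rewrite /w in H4 *.
move: H1 H3 H4 H5 Hb; rewrite -/C /=.
clearbody C xi; clear; move: (xi `^ p) (x `^ p) (m `^ p) (b `^ p) (b `^ s)
  (m `^ (p - 1)) (m `^ (p - 2) * xi ^+ 2) (b `^ ((p - 2) * (1 - k)))
  (b `^ (p - 2 + 2 * k)) (b `^ (p - 1)) => q1 q2 q3 q4 q5 q6 q7 W B q8.
lra.
Qed.

(** * Functions measurable for a sub-sigma-algebra *)

Section sub_sigma_algebra.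
Context (d : measure_display) (Omega : measurableType d) (R : realType).
Variable G : set (set Omega).
Hypothesis sG : sigma_algebra setT G.
Hypothesis GM : G `<=` measurable.

Local Notation GT := (g_sigma_algebraType G).

Lemma measurable_subE : @measurable _ GT = G.
Proof. exact: sigma_algebra_id. Qed.

Lemma measurable_wrt_fun d' (U : measurableType d') (f : Omega -> U) :
  measurable_wrt G (@measurable _ U) f <->
  measurable_fun setT (f : GT -> U).
Proof.
split=> [mf _ B mB|mf B mB].
  by rewrite setTI measurable_subE; exact: mf.
by rewrite -measurable_subE -[_ @^-1` _]setTI; exact: mf.
Qed.

Lemma measurable_fun_sub d' (U : measurableType d') (f : Omega -> U) :
  measurable_fun setT (f : GT -> U) -> measurable_fun setT f.
Proof.
move=> mf _ B mB; apply: GM; rewrite -measurable_subE.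
exact: mf.
Qed.

Variable P : probability Omega R.
Local Open Scope ereal_scope.
Import HBNNSimple.

(** Expresses the integral of h f through the integrals of f over level sets of
    G-measurable simple functions which depend on h only: two functions f with
    the same integrals over G therefore have the same integrals against h. *)
Lemma integral_mul_approx (h : Omega -> R) (f : Omega -> \bar R) (E : set Omega)
  (mh : measurable_fun setT (EFin \o h : GT -> \bar R)) :
  (forall w, 0 <= h w)%R -> (forall w, 0 <= f w) -> measurable_fun setT f ->
  G E ->
  \int[P]_(w in E) ((h w)%:E * f w) =
  limn (fun n => \sum_(k \in range (nnsfun_approx measurableT mh n))
     k%:E * \int[P]_(w in E `&` (nnsfun_approx measurableT mh n @^-1` [set k])) f w).
Proof.
move=> h0 f0 mf GE; have mE := GM GE.
set h_ := nnsfun_approx measurableT mh.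
have mh_ n : measurable_fun setT (h_ n : Omega -> R).
  by apply: measurable_fun_sub; exact: measurable_funP.
have mhf n : measurable_fun E (fun w => (h_ n w)%:E * f w).
  apply: emeasurable_funM; last exact: measurable_funTS.
  by apply/measurable_EFinP; exact: measurable_funTS.
have -> : \int[P]_(w in E) ((h w)%:E * f w) =
    limn (fun n => \int[P]_(w in E) ((h_ n w)%:E * f w)).
  rewrite -monotone_convergence //; last first.
  - move=> w _ m n mn; apply: lee_wpmul2r => //; rewrite lee_fin.
    by have /lefP := nd_nnsfun_approx measurableT mh mn; exact.
  - by move=> n w _; rewrite mule_ge0 // lee_fin.
  apply: eq_integral => w _; apply/esym/cvg_lim => //.
  have hw : (h_ n w)%:E @[n --> \oo] --> (h w)%:E.
    exact: (@cvg_nnsfun_approx _ _ _ _ measurableT _ mh (fun x _ => h0 x) w).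
  (* Where f is infinite, h w = 0 is special: the product 0 * oo is 0, and the
     approximations of h vanish as well. *)
  have [fw|fw] := boolP (f w \is a fin_num); first exact: cvgeZr.
  have [hw0|hw0] := eqVneq (h w) 0%R.
    have z n : h_ n w = 0%R.
      apply/eqP; rewrite eq_le; apply/andP; split => //.
      have : ((h_ n w)%:E <= (h w)%:E).
        have <- : limn (fun n => (h_ n w)%:E) = (h w)%:E by exact/cvg_lim.
        apply: lime_ge; first by apply/cvg_ex; exists (h w)%:E.
        exists n => // j /= nj; rewrite lee_fin.
        by have /lefP := nd_nnsfun_approx measurableT mh nj; exact.
      by rewrite hw0 lee_fin.
    under eq_fun do rewrite z mul0e.
    by rewrite hw0 mul0e; exact: cvg_cst.
  apply: (@cvgeM _ _ _ _ (fun n => (h_ n w)%:E) (fun=> f w)) => //.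
    exact: mule_def_neq0_infty.
  exact: cvg_cst.
congr (limn _); apply/funext => n.
have mk k : measurable (h_ n @^-1` [set k] : set Omega).
  by rewrite -[_ @^-1` _]setTI; apply: mh_.
transitivity (\int[P]_(w in E) \sum_(k \in range (h_ n))
    (k%:E * (f \_ (h_ n @^-1` [set k])) w)).
  apply: eq_integral => w _.
  rewrite (fsbigD1 (h_ n w)) //=; last by exists w.
  rewrite patchE mem_set // fsbig1 ?adde0 // => k /= [_ kw].
  by rewrite patchE memNset ?mule0 // => /esym.
rewrite ge0_integral_fsum //; last 2 first.
- move=> k; apply: emeasurable_funM => //.
  by apply: measurable_funTS; apply/(measurable_restrictT _ _).1 => //; exact: measurable_funTS.
- move=> k w _; rewrite patchE; case: ifPn => [/set_mem <-|_].
    by rewrite mule_ge0 // lee_fin.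
  by rewrite mule0.
apply: eq_fsbigr => k /set_mem [w _ <-].
rewrite ge0_integralZl //; first by rewrite -integral_mkcondr.
- by apply: measurable_funTS; apply/(measurable_restrictT _ _).1 => //; exact: measurable_funTS.
- by move=> v _; rewrite patchE; case: ifPn.
- by rewrite lee_fin.
Qed.

Lemma cond_exp_pull_out (h : Omega -> R) (f g : Omega -> \bar R) (E : set Omega) :
  cond_exp_version_ge0 P G f g ->
  (forall w, 0 <= f w) -> measurable_fun setT f ->
  (forall w, 0 <= h w)%R -> measurable_fun setT (h : GT -> R) -> G E ->
  \int[P]_(w in E) ((h w)%:E * g w) = \int[P]_(w in E) ((h w)%:E * f w).
Proof.
move=> [g0 mg fg] f0 mf h0 mh GE.
have mh' : measurable_fun setT (EFin \o h : GT -> \bar R).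
  exact/measurable_EFinP.
have mg' : measurable_fun setT g.
  by apply: measurable_fun_sub; exact/measurable_wrt_fun.
rewrite !(integral_mul_approx mh') //.
congr (limn _); apply/funext => n; apply: eq_fsbigr => k _; congr (_ * _).
apply: fg.
have GEE : @measurable _ GT E by rewrite measurable_subE.
suff : @measurable _ GT (E `&` nnsfun_approx measurableT mh' n @^-1` [set k]).
  by move: (_ `&` _) => B; rewrite measurable_subE.
by apply: measurableI => //; exact: measurable_funPTI.
Qed.

End sub_sigma_algebra.

(** * Versions of conditional expectations *)

Section conditional_expectation.
Context (d : measure_display) (Omega : measurableType d) (R : realType).
Variables (P : probability Omega R) (G : set (set Omega)).
Hypothesis sG : sigma_algebra setT G.
Hypothesis GM : G `<=` measurable.

Local Notation GT := (g_sigma_algebraType G).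
Local Open Scope ereal_scope.

Lemma integral_le_cst (f : Omega -> \bar R) (E : set Omega) (N : R) :
  measurable E -> (0 <= N)%R -> (forall w, 0 <= f w) -> measurable_fun setT f ->
  (forall w, E w -> f w <= N%:E) -> \int[P]_(w in E) f w <= N%:E.
Proof.
move=> mE N0 f0 mf fN.
apply: (@le_trans _ _ (\int[P]_(w in E) cst N%:E w)).
  apply: ge0_le_integral => //; first exact: measurable_funTS.
rewrite integral_cst //; apply: (@le_trans _ _ (N%:E * 1)); last by rewrite mule1.
by apply: lee_wpmul2l; rewrite ?probability_le1 // lee_fin.
Qed.

(** The comparison is only required on sets where v is bounded, so that v need
    not be integrable. *)
Lemma ae_le_of_integral_le (u : Omega -> \bar R) (v : Omega -> R) (D0 : set Omega) :
  G D0 -> (forall w, 0 <= u w) -> (forall w, 0 <= v w)%R ->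
  measurable_fun setT (u : GT -> \bar R) -> measurable_fun setT (v : GT -> R) ->
  (forall E N, G E -> E `<=` D0 -> (forall w, E w -> v w <= N)%R ->
     \int[P]_(w in E) u w <= \int[P]_(w in E) (v w)%:E) ->
  {ae P, forall w, D0 w -> u w <= (v w)%:E}.
Proof.
move=> GD u0 v0 mu mv H.
have muO := measurable_fun_sub sG GM mu.
have mvO := measurable_fun_sub sG GM mv.
(* On E k, integrating u - v >= 1/(k+1) > 0 forces E k to be null; the
   single index k serves both as bound for v and as gap. *)
pose E (k : nat) := D0 `&` [set w | (v w)%:E <= k%:R%:E]
  `&` [set w | (v w + k.+1%:R^-1)%:E <= u w].
have mvE : measurable_fun setT (EFin \o v : GT -> \bar R) by exact/measurable_EFinP.
have GE k : G (E k).
  rewrite -(measurable_subE sG).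
  have mD : @measurable _ GT D0 by rewrite measurable_subE.
  have m1 : @measurable _ GT (D0 `&` [set w | (v w)%:E <= k%:R%:E]).
    exact: emeasurable_fun_infty_c (measurable_funS _ _ mvE) _.
  apply: (@measurable_lee _ GT R _ m1) => //.
  - apply/measurable_EFinP; apply: measurable_funD => //.
    exact: measurable_funTS.
  - exact: measurable_funTS.
have E0 k : P (E k) = 0.
  have mE := GM (GE k).
  have ED : E k `<=` D0 by move=> w [[]].
  have vk w : E k w -> (v w <= k%:R)%R by move=> [[_]]; rewrite /= lee_fin.
  have := H _ _ (GE k) ED vk.
  set c : R := (k.+1%:R^-1)%R.
  have c0 : (0 < c)%R by rewrite invr_gt0.
  have fin : \int[P]_(w in E k) (v w)%:E < +oo.
    apply: (le_lt_trans (integral_le_cst (N := k%:R) mE _ _ _ _)) (ltry _).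
    - exact: ler0n.
    - by move=> w; rewrite /= lee_fin.
    - exact/measurable_EFinP.
    - by move=> w Ew; rewrite /= lee_fin vk.
  have fin' : \int[P]_(w in E k) (v w)%:E \is a fin_num.
    by rewrite ge0_fin_numE //; apply: integral_ge0 => w _; rewrite lee_fin.
  move=> h.
  have : \int[P]_(w in E k) (v w)%:E + c%:E * P (E k) <= \int[P]_(w in E k) (v w)%:E + 0.
    rewrite adde0; apply: le_trans h; rewrite -integral_cst // -ge0_integralD //.
    - apply: ge0_le_integral => //.
      + by move=> w _; rewrite adde_ge0 // lee_fin // ltW.
      + apply: emeasurable_funD; last exact: measurable_cst.
        by apply/measurable_EFinP; exact: measurable_funTS.
      + exact: measurable_funTS.
      + by move=> w [_] /=; rewrite EFinD.
    - by move=> w _; rewrite lee_fin.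
    - by apply/measurable_EFinP; exact: measurable_funTS.
    - by move=> w _; rewrite lee_fin ltW.
  rewrite leeD2lE // pmule_rle0 ?lte_fin // => PE.
  by apply/eqP; rewrite eq_le PE measure_ge0.
have : P.-negligible (\bigcup_k E k).
  apply: negligible_bigcup => k; exists (E k).
  by split; [exact: GM|exact: E0|].
move=> neg; apply: (negligibleS _ neg) => w /= /not_implyP [Dw /negP]; rewrite -ltNge => vu.
have [k [vk uk]] : exists k : nat, (v w <= k%:R)%R /\ (v w + k.+1%:R^-1)%:E <= u w.
  have [k0 vk0] : exists k0 : nat, (v w <= k0%:R)%R.
    exists (Num.truncn (v w)).+1; have /andP[_ /ltW] := truncn_itv (v0 w); exact.
  have [k1 hk1] : exists k1 : nat, forall k : nat, (k1 <= k)%N -> (v w + k.+1%:R^-1)%:E <= u w.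
    move: vu; case: (u w) (u0 w) => [x| |] //=; last first.
      by move=> _ _; exists 0%N => k _; rewrite leey.
    rewrite lte_fin => _ vx; pose y := (x - v w)^-1%R.
    have xv : (0 < x - v w)%R by rewrite subr_gt0.
    exists (Num.truncn y) => k kk; rewrite lee_fin -lerBrDl.
    have y0 : (0 <= y)%R by rewrite invr_ge0 ltW.
    rewrite -[leRHS]invrK lef_pV2 ?posrE ?ltr0n ?invr_gt0 //.
    have /andP[_ /ltW h] := truncn_itv y0; apply: le_trans h _.
    by rewrite ler_nat.
  exists (maxn k0 k1); split; last by apply: hk1; rewrite leq_maxr.
  by apply: le_trans vk0 _; rewrite ler_nat leq_maxl.
by exists k => //; split => //; split => //=; rewrite lee_fin.
Qed.

Lemma cond_exp_version_nonneg (f g : Omega -> \bar R) :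
  (forall w, 0 <= f w) -> cond_exp_version P G f g ->
  exists2 g', cond_exp_version_ge0 P G f g' & {ae P, forall w, g w = g' w}.
Proof.
move=> f0 [mg [gp [gn [Hp Hn _ Hg]]]].
have fp : f^\+ = f.
  by apply/funext => w; rewrite (@ge0_funeposE _ _ setT) // ?inE.
have fn : f^\- = cst 0.
  by apply/funext => w; rewrite (@ge0_funenegE _ _ setT) // ?inE.
rewrite fp in Hp; exists gp => //.
case: Hn => gn0 /(measurable_wrt_fun sG) mgn.
have mgnO := measurable_fun_sub sG GM mgn.
move=> /(_ setT); rewrite fn integral_cst // mul0e => gnint.
have GT' : G setT by rewrite -(measurable_subE sG).
have : ae_eq P setT gn (cst 0).
  apply/ae_eq_integral_abs => //; rewrite -[RHS](gnint GT').
  by apply: eq_integral => w _; rewrite gee0_abs.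
apply: filterS2 Hg => w -> gnw; by rewrite gnw // sube0.
Qed.

(** The drift is a difference of two versions, possibly both of infinite mean. On
    a set where V <= N the negative part is at most N, so it can be cancelled in
    V' + (V' - V)^- = V + (V' - V)^+ after integration. *)
Lemma drift_pointwise (V V' : Omega -> R) (e g : Omega -> \bar R)
    (D0 : set Omega) (A : R) :
  (forall w, 0 <= V w)%R -> (forall w, 0 <= V' w)%R -> (0 < A)%R ->
  measurable_fun setT (V : GT -> R) -> measurable_fun setT V' -> G D0 ->
  cond_exp_version_ge0 P G (EFin \o V') e ->
  cond_exp_version P G (fun w => (V' w - V w)%:E) g ->
  {ae P, forall w, D0 w -> g w <= (- A)%:E} ->
  {ae P, forall w, D0 w -> e w + A%:E <= (V w)%:E}.
Proof.
move=> V0 V'0 A0 mV mV' GD [e0 me eint] [_ [gp [gn [[gp0 mgp gpint] [gn0 mgn gnint] _ Hg]]]] gA.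
have mVO := measurable_fun_sub sG GM mV.
have meG := (measurable_wrt_fun sG _).1 me.
have meO := measurable_fun_sub sG GM meG.
have mgpO := measurable_fun_sub sG GM ((measurable_wrt_fun sG _).1 mgp).
have mgnO := measurable_fun_sub sG GM ((measurable_wrt_fun sG _).1 mgn).
have gpn : {ae P, forall w, D0 w -> gp w + A%:E <= gn w}.
  apply: filterS2 Hg gA => w -> gA Dw; move: (gA Dw).
  move: (gp w) (gn w) (gp0 w) (gn0 w) => [a| |] [b| |] //=; rewrite ?leey //.
  by rewrite -EFinB -EFinD !lee_fin => _ _; lra.
apply: ae_le_of_integral_le => //.
- by move=> w; rewrite adde_ge0 // lee_fin ltW.
- by apply: emeasurable_funD => //; exact: measurable_cst.
move=> E N GE ED VN; have mE := GM GE.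
pose f := fun w => (V' w - V w)%:E : \bar R.
have mf : measurable_fun setT f by apply/measurable_EFinP; exact: measurable_funB.
have fin : \int[P]_(w in E) gn w \is a fin_num.
  rewrite ge0_fin_numE; last by apply: integral_ge0.
  rewrite gnint //; pose M := Num.max N 0%R.
  apply: (le_lt_trans (integral_le_cst (N := M) mE _ _ _ _)) (ltry _).
  - by rewrite /M le_max lexx orbT.
  - by move=> w; rewrite funeneg_ge0.
  - exact: measurable_funeneg.
  - move=> w /VN; have := V0 w; have := V'0 w => a b c.
    by rewrite funenegE ge_max /f -EFinN !lee_fin /M !le_max lexx orbT andbT; apply/orP; left; lra.
rewrite -(leeD2rE _ _ fin).
rewrite (ge0_integralD P mE); last 4 first.
- by move=> w _.
- exact: measurable_funTS.
- by move=> w _; rewrite lee_fin ltW.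
- exact: measurable_cst.
rewrite eint // gnint // addeAC -(ge0_integralD P mE); last 4 first.
- by move=> w _; rewrite lee_fin.
- by apply/measurable_EFinP; exact: measurable_funTS.
- by move=> w _; rewrite funeneg_ge0.
- by apply: measurable_funTS; exact: measurable_funeneg.
have -> : \int[P]_(w in E) ((EFin \o V') w + f^\- w)
   = \int[P]_(w in E) ((V w)%:E + f^\+ w).
  apply: eq_integral => w _; rewrite funenegE funeposE [in LHS]/comp.
  have fE : f w = (V' w - V w)%:E by [].
  have nfE : - f w = (V w - V' w)%:E by rewrite fE -EFinN opprB.
  have [vv|/ltW vv] := leP (V w) (V' w).
    have f0 : 0 <= f w by rewrite fE lee_fin subr_ge0.
    have n0 : - f w <= 0 by rewrite nfE lee_fin subr_le0.
    by rewrite (max_l f0) (max_r n0) fE -!EFinD addr0 subrKC.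
  have f0 : f w <= 0 by rewrite fE lee_fin subr_le0.
  have n0 : 0 <= - f w by rewrite nfE lee_fin subr_ge0.
  by rewrite (max_r f0) (max_l n0) nfE -!EFinD addr0 subrKC.
rewrite (ge0_integralD P mE); last 4 first.
- by move=> w _; rewrite lee_fin.
- by apply/measurable_EFinP; exact: measurable_funTS.
- by move=> w _; rewrite funepos_ge0.
- by apply: measurable_funTS; exact: measurable_funepos.
rewrite -addeA -gpint // -gnint //; apply: leeD2l.
rewrite -(ge0_integralD P mE); last 4 first.
- by move=> w _.
- exact: measurable_funTS.
- by move=> w _; rewrite lee_fin ltW.
- exact: measurable_cst.
apply: ae_ge0_le_integral => //.
- by move=> w _; rewrite adde_ge0 // lee_fin ltW.
- by apply: measurable_funTS; apply: emeasurable_funD => //; exact: measurable_cst.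
- exact: measurable_funTS.
- by apply: filterS gpn => w h /ED.
Qed.

End conditional_expectation.

(** * One step of the process *)

Section one_step.
Context (d : measure_display) (Omega : measurableType d) (R : realType).
Variables (P : probability Omega R) (G : set (set Omega)).
Hypothesis sG : sigma_algebra setT G.
Hypothesis GM : G `<=` measurable.

Local Notation GT := (g_sigma_algebraType G).
Local Open Scope ereal_scope.

(** What the hypotheses say about a single step from V to V', for a
    real-valued version e of E[V' | G]; psi dominates the conditional p-th
    moment of V' - e. Conditional statements are given in integrated form,
    against nonnegative G-measurable weights h. *)
Record predictor (D0 : set Omega) (V V' psi : Omega -> R) (A p B0 : R)
    (e : Omega -> R) : Prop := Predictor {
  predictor_ge0 : forall w, (0 <= e w)%R ;
  predictor_measurable : measurable_fun setT (e : GT -> R) ;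
  predictor_mean : forall (h : Omega -> R) (E : set Omega),
    (forall w, 0 <= h w)%R -> measurable_fun setT (h : GT -> R) -> G E ->
    \int[P]_(w in E) (h w * e w)%:E = \int[P]_(w in E) (h w * V' w)%:E ;
  predictor_error : forall (h : Omega -> R) (E : set Omega),
    (forall w, 0 <= h w)%R -> measurable_fun setT (h : GT -> R) -> G E ->
    \int[P]_(w in E) (h w * `|V' w - e w| `^ p)%:E
      <= \int[P]_(w in E) (h w * psi w)%:E ;
  predictor_drift : {ae P, forall w, ~ D0 w -> (e w + A <= V w)%R} ;
  predictor_return : \int[P]_(w in D0) (e w `^ p)%:E <= B0%:E }.

(** The given version of E[V' | G] is replaced by a nonnegative one, which is
    almost surely finite: off D0 by the drift, on D0 by the return moment. *)
Lemma predictor_exists (D0 : set Omega) (V V' psi : Omega -> R) (A p B0 : R)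
    (EV drift Xi : Omega -> \bar R) :
  G D0 -> (0 < A)%R -> (0 < p)%R ->
  (forall w, 0 <= V w)%R -> (forall w, 0 <= V' w)%R ->
  (forall w, 0 <= psi w)%R ->
  measurable_fun setT (V : GT -> R) -> measurable_fun setT V' ->
  measurable_fun setT (psi : GT -> R) ->
  cond_exp_version P G (EFin \o V') EV ->
  cond_exp_version P G (fun w => (V' w - V w)%:E) drift ->
  cond_exp_version P G (fun w => poweR `|(V' w)%:E - EV w| p) Xi ->
  {ae P, forall w, ~ D0 w -> drift w <= (- A)%:E} ->
  {ae P, forall w, Xi w <= (psi w)%:E} ->
  \int[P]_(w in D0) poweR (EV w) p < B0%:E ->
  exists e, predictor D0 V V' psi A p B0 e.
Proof.
move=> GD A0 p0 V0 V'0 psi0 mV mV' mpsi hEV hdrift hXi ha hb hc.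
have mD0 := GM GD.
have V'0e w : 0 <= (EFin \o V') w by rewrite lee_fin.
have [eE HeE EVe] := cond_exp_version_nonneg sG GM V'0e hEV.
have [Xi' HXi XiE] := cond_exp_version_nonneg sG GM (fun w => poweR_ge0 _ _) hXi.
have mEV : measurable_fun setT EV.
  by apply: (measurable_fun_sub sG GM); apply/(measurable_wrt_fun sG); case: hEV.
have meEG : measurable_fun setT (eE : GT -> \bar R).
  by apply/(measurable_wrt_fun sG); case: HeE.
have meE := measurable_fun_sub sG GM meEG.
have eE0 : forall w, 0 <= eE w by case: HeE.
have GDC : G (~` D0).
  rewrite -(measurable_subE sG); apply: (@measurableC _ GT).
  by rewrite measurable_subE.
have drift_le := drift_pointwise sG GM V0 V'0 A0 mV mV' GDC HeE hdrift ha.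
have mpow : measurable_fun setT (fun w => poweR (eE w) p).
  by exact: (measurableT_comp (measurable_poweR p)).
have ret : \int[P]_(w in D0) poweR (eE w) p < B0%:E.
  apply: le_lt_trans hc; apply: ae_ge0_le_integral => //.
  - by move=> w _; exact: poweR_ge0.
  - exact: measurable_funTS.
  - by move=> w _; exact: poweR_ge0.
  - apply: measurable_funTS; exact: (measurableT_comp (measurable_poweR p)).
  - by apply: filterS EVe => w ->.
have finD : {ae P, forall w, D0 w -> poweR (eE w) p \is a fin_num}.
  apply: integrable_ae => //; apply/integrableP; split.
    exact: measurable_funTS.
  apply: le_lt_trans (lt_trans ret (ltry _)).
  apply: ge0_le_integral => //.
  - by apply: measurableT_comp => //; exact: measurable_funTS.
  - exact: measurable_funTS.
  - by move=> w _; rewrite gee0_abs // poweR_ge0.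
have fin : {ae P, forall w, eE w \is a fin_num}.
  apply: filterS2 finD drift_le => w fD dr.
  rewrite ge0_fin_numE //.
  have [Dw|nDw] := pselect (D0 w).
    have := fD Dw; rewrite ge0_fin_numE ?poweR_ge0 //.
    by apply: lty_poweRy; rewrite gt_eqF.
  have := dr nDw; case: (eE w) => [x| |] //=.
  by rewrite ltry.
pose e w := fine (eE w).
have eE_e : {ae P, forall w, eE w = (e w)%:E}.
  by apply: filterS fin => w; rewrite /e => h; rewrite fineK.
have me : measurable_fun setT (e : GT -> R).
  by apply: (@measurableT_comp _ _ _ _ _ _ fine) => //; exact: fine_measurable.
have meO := measurable_fun_sub sG GM me.
have e0 w : (0 <= e w)%R by rewrite /e fine_ge0.
exists e; split => //.
- move=> h E h0 mh GE; have mE := GM GE.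
  have mhO := measurable_fun_sub sG GM mh.
  under [RHS]eq_integral do rewrite EFinM.
  rewrite -[RHS](cond_exp_pull_out sG GM HeE) //; last exact/measurable_EFinP.
  apply: ge0_ae_eq_integral => //.
  + apply/measurable_EFinP; apply: measurable_funTS; exact: measurable_funM.
  + apply: measurable_funTS; apply: emeasurable_funM => //.
    exact/measurable_EFinP.
  + by move=> w _; rewrite lee_fin mulr_ge0.
  + by move=> w _; rewrite mule_ge0 // lee_fin.
  + by apply: filterS eE_e => w -> _; rewrite EFinM.
- move=> h E h0 mh GE; have mE := GM GE.
  have mhO := measurable_fun_sub sG GM mh.
  have mf : measurable_fun setT (fun w => poweR `|(V' w)%:E - EV w| p).
    apply: (measurableT_comp (measurable_poweR p)).
    apply: measurableT_comp => //; apply: emeasurable_funB => //.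
    exact/measurable_EFinP.
  apply: (@le_trans _ _ (\int[P]_(w in E) ((h w)%:E * poweR `|(V' w)%:E - EV w| p))).
    apply: ae_ge0_le_integral => //.
    + by move=> w _; rewrite lee_fin mulr_ge0 // powR_ge0.
    + apply/measurable_EFinP; apply: measurable_funTS; apply: measurable_funM => //.
      apply: (measurableT_comp (measurable_powR p)).
      by apply: measurableT_comp => //; exact: measurable_funB.
    + by move=> w _; rewrite mule_ge0 // ?lee_fin // poweR_ge0.
    + apply: measurable_funTS; apply: emeasurable_funM => //.
      exact/measurable_EFinP.
    + by apply: filterS2 EVe eE_e => w -> -> _; rewrite -EFinB /= EFinM.
  rewrite -(cond_exp_pull_out sG GM HXi) //; last by move=> w; exact: poweR_ge0.
  have mXi : measurable_fun setT Xi'.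
    by apply: (measurable_fun_sub sG GM); apply/(measurable_wrt_fun sG); case: HXi.
  have mpsiO := measurable_fun_sub sG GM mpsi.
  have Xi0 : forall w, 0 <= Xi' w by case: HXi.
  apply: ae_ge0_le_integral => //.
  + by move=> w _; rewrite mule_ge0 // lee_fin.
  + apply: measurable_funTS; apply: emeasurable_funM => //.
    exact/measurable_EFinP.
  + by move=> w _; rewrite lee_fin mulr_ge0.
  + by apply/measurable_EFinP; apply: measurable_funTS; exact: measurable_funM.
  + by apply: filterS2 XiE hb => w -> hw _; rewrite EFinM; apply: lee_wpmul2l; rewrite ?lee_fin.
- by apply: filterS2 eE_e drift_le => w -> h /h; rewrite -EFinD lee_fin.
- apply: le_trans (ltW ret); apply: ae_ge0_le_integral => //.
  + by move=> w _; rewrite lee_fin powR_ge0.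
  + apply/measurable_EFinP; apply: measurable_funTS.
    by apply: (measurableT_comp (measurable_powR p)).
  + by move=> w _; exact: poweR_ge0.
  + exact: measurable_funTS.
  + by apply: filterS eE_e => w ->.
Qed.



Lemma powR_add3_le (x y z p : R) :
  (0 <= x)%R -> (0 <= y)%R -> (0 <= z)%R -> (0 <= p)%R ->
  ((x + y + z) `^ p <= 3 `^ p * (x `^ p + y `^ p + z `^ p))%R.
Proof.
move=> x0 y0 z0 p0.
have H (t : R) : (0 <= t -> x <= t -> y <= t -> z <= t ->
    t `^ p <= x `^ p + y `^ p + z `^ p ->
    (x + y + z) `^ p <= 3 `^ p * (x `^ p + y `^ p + z `^ p))%R.
  move=> t0 xt yt zt tS; apply: (@le_trans _ _ ((3 * t) `^ p)%R).
    by apply: ge0_ler_powR; rewrite ?nnegrE //; lra.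
  by rewrite powRM // ler_wpM2l // powR_ge0.
have := powR_ge0 x p; have := powR_ge0 y p; have := powR_ge0 z p => a b c.
have [xy|/ltW yx] := leP x y; have [yz|/ltW zy] := leP y z;
  have [xz|/ltW zx] := leP x z; first [apply: (H x); lra|apply: (H y); lra|apply: (H z); lra].
Qed.

(** Controls V' after a visit to a sublevel set, through V' = e + (V' - e): the
    mean e is at most V off D0 and has bounded p-th moment on D0. *)
Lemma return_bound (D0 : set Omega) (V V' psi e : Omega -> R)
    (A p B0 K M : R) (E : set Omega) (delta : R) :
  predictor D0 V V' psi A p B0 e ->
  G D0 -> (0 < A)%R -> (0 < p)%R -> (0 <= K)%R -> (0 <= M)%R -> (0 <= delta)%R ->
  (forall w, 0 <= V' w)%R -> (forall w, 0 <= psi w)%R ->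
  measurable_fun setT V' -> measurable_fun setT (psi : GT -> R) -> G E ->
  (forall w, E w -> V w <= K)%R -> (forall w, E w -> psi w <= M)%R ->
  \int[P]_(w in E) ((V' w + delta) `^ p)%:E
    <= (3 `^ p * (M + (B0 + K `^ p) + delta `^ p))%:E.
Proof.
move=> [e0 meG _ herr hdr hret] GD A0 p0 K0 M0 d0 V'0 psi0 mV' mpsi GE VK psiM.
have mE := GM GE; have mD0 := GM GD.
have me := measurable_fun_sub sG GM meG.
have mpsiO := measurable_fun_sub sG GM mpsi.
have mpow (f : Omega -> R) : measurable_fun setT f ->
    measurable_fun setT (fun w => (f w `^ p)%:E).
  by move=> mf; apply/measurable_EFinP; apply: (measurableT_comp (measurable_powR p)).
have mxi : measurable_fun setT (fun w => (`|V' w - e w| `^ p)%:E).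
  by apply: mpow; apply: measurableT_comp => //; exact: measurable_funB.
have mep := mpow _ me.
have xi_le : \int[P]_(w in E) (`|V' w - e w| `^ p)%:E <= M%:E.
  have := herr (cst 1%R) E (fun _ => ler01) (measurable_cst _) GE.
  under eq_integral do rewrite mul1r.
  move=> h; apply: le_trans h _; apply: integral_le_cst => //.
  - by move=> w; rewrite lee_fin mul1r.
  - by apply/measurable_EFinP; exact: measurable_funM.
  - by move=> w Ew; rewrite lee_fin mul1r psiM.
have e_le : \int[P]_(w in E) (e w `^ p)%:E <= (B0 + K `^ p)%:E.
  rewrite -(setUIDK E D0) ge0_integral_setU //; last 5 first.
  - exact: measurableI.
  - exact: measurableD.
  - exact: measurable_funTS.
  - by move=> w _; rewrite lee_fin powR_ge0.
  - by apply/disj_setPS => w [[_ a] [_ b]].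
  rewrite EFinD; apply: leeD.
    apply: le_trans hret; apply: ge0_subset_integral => //.
    - exact: measurableI.
    - exact: measurable_funTS.
    - by move=> w _; rewrite lee_fin powR_ge0.
  apply: (@le_trans _ _ (\int[P]_(w in E `\` D0) cst (K `^ p)%:E w)).
    apply: ae_ge0_le_integral => //.
    - exact: measurableD.
    - by move=> w _; rewrite lee_fin powR_ge0.
    - exact: measurable_funTS.
    - by move=> w _; rewrite lee_fin powR_ge0.
    - apply: filterS hdr => w h [Ew Dw]; rewrite lee_fin.
      apply: ge0_ler_powR; rewrite ?nnegrE ?(ltW p0) //.
      by have := h Dw; have := VK w Ew; lra.
  apply: integral_le_cst => //; first exact: measurableD.
  - by rewrite powR_ge0.
  - by move=> w; rewrite lee_fin powR_ge0.
apply: (@le_trans _ _ (\int[P]_(w in E)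
   ((3 `^ p)%:E * ((`|V' w - e w| `^ p)%:E + (e w `^ p)%:E + (delta `^ p)%:E)))).
  apply: ge0_le_integral => //.
  - by move=> w _; rewrite lee_fin powR_ge0.
  - by apply: measurable_funTS; apply: mpow; exact: measurable_funD.
  - apply: measurable_funTS; apply: emeasurable_funM => //.
    by apply: emeasurable_funD; [exact: emeasurable_funD|].
  - move=> w _; rewrite -!EFinD -EFinM lee_fin.
    apply: le_trans (powR_add3_le _ _ _ _) => //; last exact: ltW.
    apply: ge0_ler_powR; rewrite ?nnegrE ?(ltW p0) ?addr_ge0 //.
    by have := ler_norm (V' w - e w); lra.
rewrite (ge0_integralZl_EFin P mE); last 3 first.
- by move=> w _; rewrite -!EFinD lee_fin !addr_ge0 ?powR_ge0.
- apply: measurable_funTS; by apply: emeasurable_funD; [exact: emeasurable_funD|].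
- by rewrite powR_ge0.
rewrite EFinM; apply: lee_wpmul2l; first by rewrite lee_fin powR_ge0.
rewrite (ge0_integralD P mE); last 4 first.
- by move=> w _; rewrite -!EFinD lee_fin !addr_ge0 ?powR_ge0.
- by apply: measurable_funTS; exact: emeasurable_funD.
- by move=> w _; rewrite lee_fin powR_ge0.
- exact: measurable_cst.
rewrite (ge0_integralD P mE); last 4 first.
- by move=> w _; rewrite lee_fin powR_ge0.
- exact: measurable_funTS.
- by move=> w _; rewrite lee_fin powR_ge0.
- exact: measurable_funTS.
rewrite EFinD (EFinD M); apply: leeD; first exact: leeD.
apply: integral_le_cst => //.
- by rewrite powR_ge0.
- by move=> w; rewrite lee_fin powR_ge0.
Qed.

(** Integrates the pathwise inequality, given as a premise. Half of the drift A is
    spent on raising the clock from c to c + A / 2, the other half on absorbing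
    the noise. *)
Lemma lyapunov_step (D0 : set Omega) (V V' psi e : Omega -> R)
    (A p B0 K Cphi s c : R) (wt : R -> R) (E : set Omega) :
  (2 < p)%R -> (0 <= s)%R -> (0 < Cphi)%R ->
  measurable_fun setT wt -> (forall b, 0 <= wt b)%R ->
  (forall b m x, K <= b -> 0 <= m -> m <= b - A / 2 -> 0 <= x ->
    x `^ p + p * m `^ (p - 1) * m + wt b * (Cphi * (1 + b `^ s))
    <= b `^ p + p * m `^ (p - 1) * x + wt b * `|x - m| `^ p)%R ->
  predictor D0 V V' psi A p B0 e ->
  (0 < A)%R -> (0 <= c)%R ->
  (forall w, 0 <= V w)%R -> (forall w, 0 <= V' w)%R ->
  (forall w, 0 <= psi w)%R -> (forall w, psi w <= Cphi * (1 + V w `^ s))%R ->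
  measurable_fun setT (V : GT -> R) -> measurable_fun setT V' ->
  measurable_fun setT (psi : GT -> R) -> G E ->
  (forall w, E w -> K <= V w)%R -> (forall w, E w -> ~ D0 w) ->
  \int[P]_(w in E) ((V' w + (c + A / 2)) `^ p)%:E
    <= \int[P]_(w in E) ((V w + c) `^ p)%:E.
Proof.
move=> p2 s0 Cphi0 mwt wt0 Hpt [e0 meG hmean herr hdr _] A0 c0 V0 V'0 psi0 psiV
  mV mV' mpsi GE VK ED.
have mE := GM GE.
have me := measurable_fun_sub sG GM meG.
have mVO := measurable_fun_sub sG GM mV.
have mpsiO := measurable_fun_sub sG GM mpsi.
have p0 : (0 < p)%R by lra.
pose b w := (V w + c)%R.
pose m w := (e w + (c + A / 2))%R.
pose x w := (V' w + (c + A / 2))%R.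
have m0 w : (0 <= m w)%R by have := e0 w; rewrite /m; lra.
have b0 w : (0 <= b w)%R by have := V0 w; rewrite /b; lra.
have x0 w : (0 <= x w)%R by have := V'0 w; rewrite /x; lra.
have mbG : measurable_fun setT (b : GT -> R) by exact: measurable_funD.
have mmG : measurable_fun setT (m : GT -> R) by exact: measurable_funD.
have mb := measurable_fun_sub sG GM mbG.
have mm := measurable_fun_sub sG GM mmG.
have mx : measurable_fun setT x by exact: measurable_funD.
pose H w := (p * m w `^ (p - 1))%R.
have H0 w : (0 <= H w)%R by rewrite mulr_ge0 ?powR_ge0 // ltW.
have mHG : measurable_fun setT (H : GT -> R).
  apply: measurable_funM => //; exact: (measurableT_comp (measurable_powR (p - 1))).
have mH := measurable_fun_sub sG GM mHG.
pose W w := wt (b w).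
have W0 w : (0 <= W w)%R by exact: wt0.
have mWG : measurable_fun setT (W : GT -> R) by exact: (measurableT_comp mwt).
have mW := measurable_fun_sub sG GM mWG.
pose xi w := (`|V' w - e w| `^ p)%R.
have xi0 w : (0 <= xi w)%R by exact: powR_ge0.
have xiE w : xi w = (`|x w - m w| `^ p)%R.
  by rewrite /xi /x /m opprD addrACA subrr addr0.
have mxi : measurable_fun setT xi.
  apply: (measurableT_comp (measurable_powR p)).
  by apply: measurableT_comp => //; exact: measurable_funB.
have mpow (f : Omega -> R) : measurable_fun setT f ->
    measurable_fun E (fun w => (f w `^ p)%:E).
  by move=> mf; apply/measurable_EFinP; apply: measurable_funTS; apply: (measurableT_comp (measurable_powR p)).
have mmul (f g : Omega -> R) : measurable_fun setT f -> measurable_fun setT g ->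
    measurable_fun E (fun w => (f w * g w)%:E).
  by move=> mf mg; apply/measurable_EFinP; apply: measurable_funTS; exact: measurable_funM.
have mul0 (f g : Omega -> R) : (forall w, 0 <= f w)%R -> (forall w, 0 <= g w)%R ->
    forall w, E w -> 0 <= (f w * g w)%:E.
  by move=> f0 g0 w _; rewrite lee_fin mulr_ge0.
have pow0 (f : Omega -> R) : forall w, E w -> 0 <= (f w `^ p)%:E.
  by move=> w _; rewrite lee_fin powR_ge0.
have mb_ae : {ae P, forall w, E w -> (m w <= b w - A / 2)%R}.
  by apply: filterS hdr => w h /ED /h; rewrite /m /b; lra.
have psib w : (psi w <= Cphi * (1 + b w `^ s))%R.
  apply: le_trans (psiV w) _; apply: ler_wpM2l; first exact: ltW.
  by rewrite lerD2l; apply: ge0_ler_powR; rewrite ?nnegrE // /b lerDl.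
have Kb w : E w -> (K <= b w)%R by move=> /VK; rewrite /b; lra.
set IB := \int[P]_(w in E) (b w `^ p)%:E.
have [IBoo|IBfin] := leP +oo IB.
  by apply: le_trans IBoo; rewrite leey.
(* The two integrals that will be cancelled are finite: each is dominated by
   a multiple of IB. For Iq this is the pathwise inequality at x = m. *)
pose Ia := \int[P]_(w in E) (H w * m w)%:E.
pose Iq := \int[P]_(w in E) (W w * psi w)%:E.
have Ia_fin : Ia \is a fin_num.
  rewrite ge0_fin_numE; last exact/integral_ge0/mul0.
  apply: (@le_lt_trans _ _ (p%:E * IB)); last first.
    by rewrite lte_mul_pinfty // lee_fin ltW.
  rewrite /IB -ge0_integralZl_EFin ?(ltW p0) //; [|exact: pow0|exact: mpow].
  apply: ae_ge0_le_integral => //.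
  - exact: mul0.
  - exact: mmul.
  - by move=> w _; rewrite lee_fin mulr_ge0 ?powR_ge0 // ltW.
  - by apply: emeasurable_funM => //; exact: mpow.
  - apply: filterS mb_ae => w h /h mbw; rewrite -EFinM lee_fin /H -mulrA.
    apply: ler_wpM2l; first exact: ltW.
    rewrite mulrC mulr_powRB1 //; apply: ge0_ler_powR; rewrite ?nnegrE ?(ltW p0) //.
    lra.
have Iq_fin : Iq \is a fin_num.
  rewrite ge0_fin_numE; last exact/integral_ge0/mul0.
  apply: le_lt_trans IBfin; apply: ae_ge0_le_integral => //.
  - exact: mul0.
  - exact: mmul.
  - exact: pow0.
  - exact: mpow.
  - apply: filterS mb_ae => w h Ew; rewrite lee_fin.
    have := Hpt _ _ _ (Kb w Ew) (m0 w) (h Ew) (m0 w).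
    rewrite subrr normr0 powR0 ?gt_eqF // mulr0 addr0 -/(W w).
    have := ler_wpM2l (W0 w) (psib w).
    by have := powR_ge0 (m w) p; lra.
have key : \int[P]_(w in E) (x w `^ p)%:E + Ia + Iq <= IB + Ia + Iq.
  have <- : \int[P]_(w in E) ((x w `^ p)%:E + (H w * m w)%:E + (W w * psi w)%:E)
     = \int[P]_(w in E) (x w `^ p)%:E + Ia + Iq.
    rewrite (ge0_integralD P mE).
    - rewrite (ge0_integralD P mE) //; [exact: pow0|exact: mpow|exact: mul0|exact: mmul].
    - by move=> w Ew; rewrite adde_ge0 ?pow0 ?mul0.
    - by apply: emeasurable_funD; [exact: mpow|exact: mmul].
    - exact: mul0.
    - exact: mmul.
  have Hx : Ia = \int[P]_(w in E) (H w * x w)%:E.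
    have spl (f : Omega -> R) : measurable_fun setT f -> (forall w, 0 <= f w)%R ->
        \int[P]_(w in E) (H w * (f w + (c + A / 2)))%:E =
        \int[P]_(w in E) (H w * f w)%:E + \int[P]_(w in E) (H w * (c + A / 2))%:E.
      move=> mf f0; rewrite -(ge0_integralD P mE).
      - by apply: eq_integral => w _; rewrite mulrDr EFinD.
      - exact: mul0.
      - exact: mmul.
      - by apply: (mul0 H (cst (c + A / 2)%R)) => // w /=; lra.
      - exact: (mmul H (cst (c + A / 2)%R)).
    by rewrite /Ia /m /x !spl // hmean.
  have Wx : \int[P]_(w in E) (W w * xi w)%:E <= Iq by exact: herr.
  apply: (@le_trans _ _ (IB + Ia + \int[P]_(w in E) (W w * xi w)%:E)); last first.
    exact: leeD2l.
  rewrite Hx /IB -(ge0_integralD P mE); last 4 first.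
  - exact: pow0.
  - exact: mpow.
  - exact: mul0.
  - exact: mmul.
  rewrite -(ge0_integralD P mE); last 4 first.
  - by move=> w Ew; rewrite adde_ge0 ?pow0 ?mul0.
  - by apply: emeasurable_funD; [exact: mpow|exact: mmul].
  - exact: mul0.
  - exact: mmul.
  apply: ae_ge0_le_integral => //.
  - by move=> w Ew; rewrite !adde_ge0 ?pow0 ?mul0.
  - apply: emeasurable_funD; last exact: mmul.
    by apply: emeasurable_funD; [exact: mpow|exact: mmul].
  - by move=> w Ew; rewrite !adde_ge0 ?pow0 ?mul0.
  - apply: emeasurable_funD; last exact: mmul.
    by apply: emeasurable_funD; [exact: mpow|exact: mmul].
  - apply: filterS mb_ae => w h Ew; rewrite -!EFinD lee_fin.
    have := Hpt _ _ _ (Kb w Ew) (m0 w) (h Ew) (x0 w).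
    have := ler_wpM2l (W0 w) (psib w).
    rewrite xiE -/(W w) -/(H w); lra.
by move: key; rewrite (leeD2rE _ _ Iq_fin) (leeD2rE _ _ Ia_fin).
Qed.

End one_step.

(** * Excursions above a level *)

Section excursions.
Context (d : measure_display) (Omega : measurableType d) (R : realType).
Variables (P : probability Omega R) (F : nat -> set (set Omega)).
Variables (V : nat -> Omega -> R) (K eps p : R).
Hypothesis hF : filtration F.
Hypothesis V0 : forall n w, 0 <= V n w.
Hypothesis mV :
  forall n, measurable_fun setT (V n : g_sigma_algebraType (F n) -> R).
Hypothesis eps0 : 0 < eps.
Hypothesis step : forall n c E, 0 <= c -> F n E ->
  (forall w, E w -> K < V n w) ->
  (\int[P]_(w in E) ((V n.+1 w + (c + eps)) `^ p)%:E
    <= \int[P]_(w in E) ((V n w + c) `^ p)%:E)%E.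

(** For i > n the condition is empty and the set is everything, which starts the
    induction in the decomposition below. *)
Definition run (i n : nat) : set Omega :=
  [set w | forall l, (i <= l <= n)%N -> K < V l w].

Let sF n : sigma_algebra setT (F n). Proof. by case: hF. Qed.
Let FM n : F n `<=` measurable. Proof. by case: hF. Qed.
Let Fmono m n : (m <= n)%N -> F m `<=` F n.
Proof. by case: hF => _ _; exact. Qed.

Let mVO n : measurable_fun setT (V n).
Proof. exact: (measurable_fun_sub (sF n) (@FM n) (@mV n)). Qed.

Lemma adapted_level n : F n [set w | V n w <= K].
Proof.
rewrite -(measurable_subE (sF n)) -[X in measurable X]setTI.
exact: measurable_fun_le.
Qed.

Let setI_F n A B : F n A -> F n B -> F n (A `&` B).
Proof.
rewrite -(measurable_subE (sF n)); exact: measurableI.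
Qed.

Let upper_level n : F n [set w | K < V n w].
Proof.
have -> : [set w | K < V n w] = ~` [set w | V n w <= K].
  by apply/seteqP; split=> w /=; rewrite real_ltNge ?num_real // => /negP.
rewrite -(measurable_subE (sF n)); apply: measurableC.
by rewrite (measurable_subE (sF n)); exact: adapted_level.
Qed.

Lemma run_adapted i k : F (i + k)%N (run i (i + k)).
Proof.
elim: k => [|k IH].
  rewrite addn0; have -> : run i i = [set w | K < V i w]; last exact: upper_level.
  apply/seteqP; split=> w /= h; first by apply: h; rewrite leqnn.
  by move=> l il; have <- : i = l by apply/eqP; rewrite eqn_leq.
have -> : run i (i + k.+1) = run i (i + k) `&` [set w | K < V (i + k.+1) w].
  apply/seteqP; split=> w /= h.
    split=> [l /andP[il lk]|]; last by apply: h; rewrite leq_addr leqnn.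
    by apply: h; rewrite il addnS leqW.
  move=> l /andP[il]; rewrite addnS leq_eqVlt => /orP[/eqP ->|lk].
    by rewrite -addnS; exact: h.2.
  by apply: h.1; rewrite il.
apply: setI_F; last exact: upper_level.
by apply: Fmono IH; rewrite addnS.
Qed.

Lemma run_measurable i n : measurable (run i n).
Proof.
have [jn|nj] := leqP i n.
  by have := @run_adapted i (n - i)%N; rewrite subnKC // => /FM.
have -> : run i n = setT; last exact: measurableT.
apply/seteqP; split => // w _ l /andP[jl ln].
by have := leq_trans jl ln; rewrite leqNgt nj.
Qed.

Let mpow n c (E : set Omega) : measurable_fun E (fun w => ((V n w + c) `^ p)%:E).
Proof.
apply/measurable_EFinP; apply: measurable_funTS.
by apply: (measurableT_comp (measurable_powR p)); exact: measurable_funD.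
Qed.

Lemma excursion_bound i k (E : set Omega) c : F i E -> 0 <= c ->
  (\int[P]_(w in E `&` run i (i + k)) ((V (i + k) w + (c + eps *+ k)) `^ p)%:E
    <= \int[P]_(w in E) ((V i w + c) `^ p)%:E)%E.
Proof.
move=> FE c0; have FEn k' : F (i + k')%N (E `&` run i (i + k')).
  apply: setI_F; last exact: run_adapted.
  by apply: Fmono FE; rewrite leq_addr.
have mE k' := FM (FEn k').
elim: k => [|k IH].
  rewrite mulr0n addr0; have := mE 0%N; rewrite addn0 => mE0.
  apply: ge0_subset_integral => //; first exact: FM FE.
  by move=> w _; rewrite lee_fin powR_ge0.
apply: le_trans IH.
apply: le_trans (step _ (FEn k) _); last 2 first.
- by rewrite addr_ge0 // mulrn_wge0 // ltW.
- by move=> w [_]; apply; rewrite leq_addr leqnn.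
rewrite addnS mulrSr addrA; apply: ge0_subset_integral => //.
- by rewrite -addnS.
- by move=> w _; rewrite lee_fin powR_ge0.
- move=> w [Ew h]; split=> // l /andP[il lk]; apply: h.
  by rewrite il leqW.
Qed.

(** Peels off, one index at a time, the paths whose last visit to the level
    happened at time j. *)
Lemma last_exit_decomposition n i (f : Omega -> \bar R) :
  (forall w, 0 <= f w)%E -> measurable_fun setT f -> (i <= n.+1)%N ->
  (\int[P]_(w in run i n) f w <= \int[P]_(w in run 0 n) f w
    + \sum_(j < i) \int[P]_(w in [set w | V j w <= K]%R `&` run j.+1 n) f w)%E.
Proof.
move=> f0 mf; elim: i => [|i IH] iin; first by rewrite big_ord0 adde0.
have mrun j := run_measurable j n.
have mlev : measurable [set w | V i w <= K] by apply: FM (adapted_level i).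
rewrite big_ord_recr /= addeA.
have -> : run i.+1 n = run i n `|` ([set w | V i w <= K] `&` run i.+1 n).
  apply/seteqP; split=> w.
    move=> h; have [Vi|Vi] := leP (V i w) K; first by right.
    left=> l /andP[]; rewrite leq_eqVlt => /orP[/eqP <- //|il ln].
    by apply: h; rewrite il.
  case=> [h l /andP[il ln]|[_ //]]; apply: h; by rewrite ln ltnW.
rewrite ge0_integral_setU //.
- have <- : [set w | V i w <= K] `&` run i.+1 n =
    [set w | V i w <= K] `&` (run i n `|` [set w | V i w <= K] `&` run i.+1 n).
    apply/seteqP; split=> w; first by move=> [a b]; split => //; right.
    move=> [a [h|//]]; split => // l /andP[il ln]; apply: h; by rewrite ln ltnW.
  by apply: leeD => //; apply: IH; exact: ltnW.
- exact: measurableI.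
- exact: measurable_funTS.
- apply/disj_setPS => w [h [/= Vi _]].
  have := h i; rewrite leqnn /= => /(_ iin); by rewrite real_ltNge ?num_real // Vi.
Qed.

(** At time n an excursion that began after time j has clock eps (n - j) =: z, and
    V_n^r <= (V_n + z)^p z^-(p-r). *)
Lemma moment_bound (r C0 C1 : R) : 1 <= K -> 0 <= r -> r < p - 1 -> 0 <= C1 ->
  (\int[P]_w ((V 0 w) `^ p)%:E <= C0%:E)%E ->
  (forall j, \int[P]_(w in [set w | V j w <= K]%R)
     ((V j.+1 w + eps) `^ p)%:E <= C1%:E)%E ->
  exists C : R, forall n, (\int[P]_w (V n w `^ r)%:E <= C%:E)%E.
Proof.
move=> K1 r0 rp C10 init ret.
have [C2 HC2] : exists C : R, forall n, \sum_(k < n) (k.+1)%:R `^ (- (p - r)) <= C.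
  by apply: sum_powRN_bounded; lra.
pose z0 := eps `^ (- (p - r)).
exists (C0 + C1 * z0 * C2 + K `^ r) => n.
have mr : measurable_fun setT (fun w => (V n w `^ r)%:E).
  by apply/measurable_EFinP; apply: (measurableT_comp (measurable_powR r)).
have r0e w : (0 <= (V n w `^ r)%:E)%E by rewrite lee_fin powR_ge0.
have mlev j : measurable [set w | V j w <= K] by apply: FM (adapted_level j).
have mrun i := run_measurable i n.
have -> : [set: Omega] = run n.+1 n.
  apply/seteqP; split => // w _ l /andP[jl ln].
  by have := leq_trans jl ln; rewrite ltnn.
apply: le_trans (last_exit_decomposition r0e mr (leqnn _)) _.
rewrite big_ord_recr /= addeA !EFinD; apply: leeD; first apply: leeD.
- apply: le_trans init.
  have FT : F 0%N setT by rewrite -(measurable_subE (sF 0)); exact: measurableT.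
  have := excursion_bound n FT (lexx 0); rewrite add0n setTI add0r => H.
  have -> : (\int[P]_w (V 0%N w `^ p)%:E = \int[P]_w ((V 0%N w + 0) `^ p)%:E)%E.
    by apply: eq_integral => w _; rewrite addr0.
  apply: le_trans H.
  apply: ge0_le_integral => //.
  + exact: measurable_funTS.
  + move=> w h; rewrite lee_fin.
    have VK : K < V n w by apply: h; rewrite leqnn.
    apply: (@le_trans _ _ (V n w `^ p)).
      by apply: ler_powR; lra.
    apply: ge0_ler_powR; rewrite ?nnegrE ?addr_ge0 ?mulrn_wge0 ?(ltW eps0) //; first lra.
    by rewrite lerDl mulrn_wge0 // ltW.
- have term (j : 'I_n) : (\int[P]_(w in [set w | V j w <= K]%R `&` run j.+1 n) (V n w `^ r)%:E
     <= (C1 * z0 * (n - j)%:R `^ (- (p - r)))%:E)%E.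
    pose k := (n - j.+1)%N; have jk : (j.+1 + k = n)%N by rewrite subnKC.
    have nj : (n - j = k.+1)%N by rewrite /k subnSK.
    have FE : F j.+1 [set w | V j w <= K] by apply: Fmono (adapted_level j).
    have := excursion_bound k FE (ltW eps0); rewrite jk.
    set z := eps + eps *+ k; have zE : z = (k.+1)%:R * eps by rewrite /z -mulrS mulr_natl.
    have z0' : 0 < z by rewrite zE mulr_gt0.
    move=> H; have {}H := le_trans H (ret j).
    have zr : z `^ (- (p - r)) = z0 * (k.+1)%:R `^ (- (p - r)).
      by rewrite zE powRM ?ltW // mulrC.
    rewrite nj -mulrA -zr.
    apply: (@le_trans _ _ (\int[P]_(w in [set w | V j w <= K]%R `&` run j.+1 n)
       ((z `^ (- (p - r)))%:E * ((V n w + z) `^ p)%:E))%E).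
      apply: ge0_le_integral => //.
      + exact: measurableI.
      + exact: measurable_funTS.
      + by apply: emeasurable_funM => //; exact: measurable_cst.
      + move=> w _; rewrite -EFinM lee_fin.
        set y := V n w + z.
        have y0 : 0 < y by rewrite /y ltr_wpDl.
        have zy : z <= y by rewrite /y lerDr.
        apply: (@le_trans _ _ (y `^ r)).
          by apply: ge0_ler_powR; rewrite ?nnegrE ?(ltW y0) // /y lerDl ltW.
        have -> : y `^ r = y `^ (- (p - r)) * y `^ p.
          rewrite -powRD; last by rewrite (gt_eqF y0) implybT.
          by congr (_ `^ _); ring.
        apply: ler_wpM2r; first exact: powR_ge0.
        rewrite !powRN lef_pV2 ?posrE ?powR_gt0 //.
        by apply: ge0_ler_powR; rewrite ?nnegrE ?(ltW y0) ?(ltW z0') //; lra.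
    have mI := measurableI _ _ (mlev j) (mrun j.+1).
    rewrite (ge0_integralZl_EFin P mI) ?powR_ge0 //.
      by rewrite mulrC EFinM; apply: lee_wpmul2l; rewrite ?lee_fin ?powR_ge0.
    by move=> w _; rewrite lee_fin powR_ge0.
  apply: le_trans (lee_sum _ (fun j (_ : true) => term j)) _.
  rewrite sumEFin lee_fin -mulr_sumr.
  apply: ler_wpM2l; first by rewrite mulr_ge0 // powR_ge0.
  rewrite (reindex_inj rev_ord_inj) /=; apply: le_trans (HC2 n).
  apply: ler_sum => k _; by rewrite subKn.
- apply: integral_le_cst => //.
  + exact: measurableI.
  + exact: powR_ge0.
  + move=> w [/= VK _]; rewrite lee_fin.
    by apply: ge0_ler_powR; rewrite ?nnegrE //; lra.
Qed.

End excursions.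

(** * Bounded moments *)

Lemma varsigma_le (R : realType) (s p : R) : 2 < p -> 0 <= s ->
  varsigma s p <= p - 1.
Proof.
move=> p2 s0; rewrite /varsigma.
have H : p * (1 - s / (p - 2)) - 1 <= p - 1.
  rewrite lerD2r ler_piMr //; first lra.
  by rewrite lerBlDr lerDl divr_ge0 //; lra.
by do 2 case: ifP => // _; lra.
Qed.

Theorem theorem2p2 (R : realType) (d : measure_display)
    (Omega : measurableType d) (P : probability Omega R)
    (S : topologicalType)
    (F : nat -> set (set Omega)) (X : nat -> Omega -> S) (x0 : S)
    (V phi : S -> R) (D : set S) (A p s Cphi B0 : R)
    (EV drift Xi : nat -> Omega -> \bar R)
    (hF : filtration F)
    (hX : adapted F X)
    (hX0 : {ae P, forall w, X 0%N w = x0})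
    (hV : measurable_wrt (@borel S) (@measurable _ R) V)
    (hV0 : forall x, 0 <= V x)
    (hphi : measurable_wrt (@borel S) (@measurable _ R) phi)
    (hphi0 : forall x, 0 <= phi x)
    (hD : borel D)
    (hA : 0 < A)
    (* EV n, drift n, Xi n are versions of E[V(X_{n+1}) | F_n],
       E[V(X_{n+1}) - V(X_n) | F_n] and
       E[|V(X_{n+1}) - E[V(X_{n+1}) | F_n]|^p | F_n] *)
    (hEV : forall n, cond_exp_version P (F n)
      (fun w => (V (X n.+1 w))%:E) (EV n))
    (hdrift : forall n, cond_exp_version P (F n)
      (fun w => (V (X n.+1 w) - V (X n w))%:E) (drift n))
    (hXi : forall n, cond_exp_version P (F n)
      (fun w => poweR `| (V (X n.+1 w))%:E - EV n w |%E p) (Xi n))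
    (ha : forall n, {ae P, forall w,
      ~ D (X n w) -> (drift n w <= (- A)%:E)%E})
    (hp : 2 < p)
    (hb : forall n, {ae P, forall w, (Xi n w <= (phi (X n w))%:E)%E})
    (hs0 : 0 <= s)
    (hs : s < p / 2 - 1)
    (hCphi : 0 < Cphi)
    (hphiV : forall x, phi x <= Cphi * (1 + V x `^ s))
    (hVD : (ereal_sup [set (V x)%:E | x in D] < +oo)%E)
    (hc : forall n,
      (\int[P]_(w in X n @^-1` D) poweR (EV n w) p < B0%:E)%E) :
  forall r : R, 0 <= r -> r < varsigma s p ->
    (ereal_sup (range (fun n => 'E_P[fun w => (V (X n w) `^ r)%R])) < +oo)%E.
Proof.
move=> r r0 rs.
have rp : r < p - 1 := lt_le_trans rs (varsigma_le hp hs0).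
have p0 : 0 < p by lra.
have A2 : 0 < A / 2 by lra.
have [sF FM Fmono] := hF.
pose U n w := V (X n w).
have U0 n w : 0 <= U n w by exact: hV0.
have wrtX (f : S -> R) n : measurable_wrt (@borel S) measurable f ->
    measurable_fun setT ((f \o X n) : g_sigma_algebraType (F n) -> R).
  move=> mf; apply/(measurable_wrt_fun (sF n)) => B mB.
  by rewrite comp_preimage; apply: hX; exact: mf.
have mU n : measurable_fun setT (U n : g_sigma_algebraType (F n) -> R).
  exact: wrtX.
have mUO n := measurable_fun_sub (sF n) (FM n) (@mU n).
have mphi n : measurable_fun setT ((phi \o X n) : g_sigma_algebraType (F n) -> R).
  exact: wrtX.
have FD n : F n (X n @^-1` D) by exact: hX.
have pred n := predictor_exists (sF n) (FM n) (FD n) hA p0 (U0 n) (U0 n.+1)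
  (fun w => hphi0 (X n w)) (@mU n) (mUO n.+1) (@mphi n) (hEV n) (hdrift n) (hXi n)
  (ha n) (hb n) (hc n).
have [MD hMD] : exists MD : R, forall x, D x -> V x <= MD.
  move: hVD; case E : (ereal_sup _) => [M| |] // _.
    exists M => x Dx; rewrite -lee_fin -E; apply: ereal_sup_ubound.
    by exists x.
  exists 0 => x Dx; have : ((V x)%:E <= -oo)%E.
    by rewrite -E; apply: ereal_sup_ubound; exists x.
  by [].
have [K0 [wt [K01 mwt wt0 Hwt]]] := lyapunov_pointwise hp hs0 hs A2 hCphi.
(* Above K the noise is under control, and the process is outside D. *)
pose K := Num.max K0 MD.
have K0K : K0 <= K by rewrite le_max lexx.
have MDK : MD <= K by rewrite le_max lexx orbT.
have K1 : 1 <= K := le_trans K01 K0K.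
have step n c E : 0 <= c -> F n E -> (forall w, E w -> K < U n w) ->
    (\int[P]_(w in E) ((U n.+1 w + (c + A / 2)) `^ p)%:E
      <= \int[P]_(w in E) ((U n w + c) `^ p)%:E)%E.
  move=> c0 FE EK; have [e He] := pred n.
  apply: (lyapunov_step (sF n) (FM n) hp hs0 hCphi mwt wt0 Hwt He) => //.
  - by move=> w /EK; move/ltW; exact: le_trans.
  - move=> w /EK Kw Dw; have := hMD _ Dw; rewrite -/(U n w); lra.
pose M := Cphi * (1 + K `^ s).
have M0 : 0 <= M by rewrite mulr_ge0 ?(ltW hCphi) // addr_ge0 // powR_ge0.
have B00 : 0 <= B0.
  rewrite -lee_fin; apply: le_trans (ltW (hc 0%N)).
  by apply: integral_ge0 => w _; exact: poweR_ge0.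
pose C1 := 3 `^ p * (M + (B0 + K `^ p) + (A / 2) `^ p).
have C10 : 0 <= C1.
  by rewrite mulr_ge0 ?powR_ge0 // !addr_ge0 ?powR_ge0.
have ret j : (\int[P]_(w in [set w | U j w <= K]%R)
     ((U j.+1 w + A / 2) `^ p)%:E <= C1%:E)%E.
  have [e He] := pred j.
  have FL : F j [set w | U j w <= K].
    rewrite -(measurable_subE (sF j)) -[X in measurable X]setTI.
    exact: measurable_fun_le.
  apply: (return_bound (sF j) (FM j) He) => //.
  - lra.
  - exact: ltW.
  - move=> w /= UK; apply: le_trans (hphiV _) _; apply: ler_wpM2l; first exact: ltW.
    by rewrite lerD2l; apply: ge0_ler_powR; rewrite ?nnegrE //; lra.
have init : (\int[P]_w ((U 0%N w) `^ p)%:E <= (V x0 `^ p)%:E)%E.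
  apply: (@le_trans _ _ (\int[P]_w cst (V x0 `^ p)%:E w)%E).
    apply: ae_ge0_le_integral => //.
    - by move=> w _; rewrite lee_fin powR_ge0.
    - by apply/measurable_EFinP; apply: (measurableT_comp (measurable_powR p)).
    - by move=> w _; rewrite lee_fin powR_ge0.
    - by apply: filterS hX0 => w XE _; rewrite /U XE.
  by apply: integral_le_cst => // [|w]; rewrite ?lee_fin powR_ge0.
have [C HC] := moment_bound hF U0 mU A2 step K1 r0 rp C10 init ret.
apply: (@le_lt_trans _ _ C%:E); last exact: ltry.
apply: ge_ereal_sup => _ [n _ <-]; rewrite unlock; exact: HC.
Qed.
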